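(* Let $g\in\mathcal H^\infty(B_{\ell_2},\ell_2)$ be a constant function with $\|g\|=1$. Then the fiber $\mathscr F(g)\subset\mathcal M_{u,\infty}(B_{\ell_2},B_{\ell_2})$ consists only of the composition homomorphism $C_g$, i.e. $\mathscr F(g)=\{C_g\}$.
   Context: All spaces are complex and $B_{\ell_2}$ is the open unit ball of $\ell_2$. $\mathcal A_u(B_{\ell_2})$ is the Banach algebra (sup norm) of holomorphic functions $f:B_{\ell_2}\to\mathbb C$ that are uniformly continuous on $B_{\ell_2}$; each such $f$ extends continuously to the closed ball $\overline B_{\ell_2}$, and the extension is still denoted $f$. $\mathcal H^\infty(B_{\ell_2})$ is the Banach algebra of bounded holomorphic functions $B_{\ell_2}\to\mathbb C$ with the sup norm; $\mathcal H^\infty(B_{\ell_2},\ell_2)$ is the Banach space of bounded holomorphic maps $B_{\ell_2}\to\ell_2$ with the norm $\|g\|=\sup_{x\in B_{\ell_2}}\|g(x)\|$. The vector-valued spectrum is $\mathcal M_{u,\infty}(B_{\ell_2},B_{\ell_2})=\{\Phi:\mathcal A_u(B_{\ell_2})\to\mathcal H^\infty(B_{\ell_2})\ \text{nonzero algebra homomorphism}\}$. With $(e_n)$ the canonical basis of $\ell_2$, the projection $\xi:\mathcal M_{u,\infty}(B_{\ell_2},B_{\ell_2})\to\mathcal H^\infty(B_{\ell_2},\ell_2)$ is $\xi(\Phi)(x)=\big(\Phi(\langle\cdot,e_n\rangle)(x)\big)_n$. The fiber over $g$ is $\mathscr F(g)=\xi^{-1}(g)$. For $g$ in the closed unit ball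 of $\mathcal H^\infty(B_{\ell_2},\ell_2)$, the composition homomorphism $C_g\in\mathcal M_{u,\infty}(B_{\ell_2},B_{\ell_2})$ is $C_g(f)=f\circ g$. *)

(* Defs.v *)
From HB Require Import structures.
From mathcomp Require Import all_boot all_order all_algebra complex.
From mathcomp Require Import all_classical all_reals all_analysis.
From mathcomp Require Import ring lra.
Set Implicit Arguments.
Unset Strict Implicit.
Unset Printing Implicit Defensive.
Import Order.TTheory GRing.Theory Num.Theory numFieldNormedType.Exports.
Import Normc.
Local Open Scope classical_set_scope.
Local Open Scope ring_scope.
Local Open Scope complex_scope.

(* The library has these instances on [R[i]^o] only. *)
HB.instance Definition _ (R : realType) := NormedModule.copy R[i] R[i]^o.

Section Ell2.
Variable R : realType.
Implicit Types x y : nat -> R[i].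

Definition sqsum x := limn (series (fun k => normc (x k) ^+ 2)).

Definition ell2_mem : {pred nat -> R[i]} :=
  mem [set x | cvgn (series (fun k => normc (x k) ^+ 2))].

Lemma ell2_memP x :
  reflect (cvgn (series (fun k => normc (x k) ^+ 2))) (x \in ell2_mem).
Proof. by apply: (iffP idP) => [/set_mem|/mem_set]. Qed.

Lemma sqsum_partial x n : x \in ell2_mem ->
  \sum_(0 <= k < n) normc (x k) ^+ 2 <= sqsum x.
Proof.
move=> /ell2_memP cx; apply: (nondecreasing_cvgn_le _ cx).
by apply/nondecreasing_seqP => m; rewrite /series/= [leRHS]big_nat_recr//= lerDl sqr_ge0.
Qed.

Lemma sqsum_ge0 x : x \in ell2_mem -> 0 <= sqsum x.
Proof. by move=> /(@sqsum_partial _ 0%N); rewrite big_nil. Qed.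

Lemma ell2_mem_bounded x (M : R) :
  (forall n, \sum_(0 <= k < n) normc (x k) ^+ 2 <= M) -> x \in ell2_mem.
Proof.
move=> H; apply/ell2_memP; apply: nondecreasing_is_cvgn.
  by apply/nondecreasing_seqP => m; rewrite /series/= [leRHS]big_nat_recr//= lerDl sqr_ge0.
by exists M => _ [n _ <-]; exact: H.
Qed.

Lemma sqsum_le x (M : R) :
  (forall n, \sum_(0 <= k < n) normc (x k) ^+ 2 <= M) -> sqsum x <= M.
Proof.
move=> H; apply: limr_le; first exact/ell2_memP/(ell2_mem_bounded H).
by apply: nearW => n; exact: H.
Qed.

Lemma normc_nneg (c : R[i]) : 0 <= normc c.
Proof. by case: c => a b; exact: sqrtr_ge0. Qed.

Lemma sum_minkowski n (a b : nat -> R) :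
  (forall k, 0 <= a k) -> (forall k, 0 <= b k) ->
  Num.sqrt (\sum_(0 <= k < n) (a k + b k) ^+ 2) <=
  Num.sqrt (\sum_(0 <= k < n) a k ^+ 2) + Num.sqrt (\sum_(0 <= k < n) b k ^+ 2).
Proof.
move=> a0 b0.
have cs : \sum_(0 <= k < n) a k * b k <=
   Num.sqrt (\sum_(0 <= k < n) a k ^+ 2) * Num.sqrt (\sum_(0 <= k < n) b k ^+ 2).
  elim: n => [|n IH]; first by rewrite !big_nil sqrtr0 mul0r.
  rewrite !big_nat_recr//=.
  set A := \sum_(_ <= _ < _) a _ ^+ _; set B := \sum_(_ <= _ < _) b _ ^+ _.
  have A0 : 0 <= A by apply: sumr_ge0 => k _; rewrite sqr_ge0.
  have B0 : 0 <= B by apply: sumr_ge0 => k _; rewrite sqr_ge0.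
  apply: (le_trans (lerD IH (lexx _))); rewrite -/A -/B.
  rewrite -[leRHS]sqrtrM ?addr_ge0 ?sqr_ge0//.
  rewrite -[leLHS]ger0_norm; last by rewrite addr_ge0 ?mulr_ge0 ?sqrtr_ge0.
  rewrite -sqrtr_sqr ler_wsqrtr//.
  have := sqr_sqrtr A0; have := sqr_sqrtr B0.
  move: (Num.sqrt A) (Num.sqrt B) => s t <- <-.
  have := sqr_ge0 (s * b n - t * a n); nra.
set A := \sum_(_ <= _ < _) a _ ^+ _; set B := \sum_(_ <= _ < _) b _ ^+ _.
have A0 : 0 <= A by apply: sumr_ge0 => k _; rewrite sqr_ge0.
have B0 : 0 <= B by apply: sumr_ge0 => k _; rewrite sqr_ge0.
rewrite -[leRHS]ger0_norm; last by rewrite addr_ge0 ?sqrtr_ge0.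
rewrite -sqrtr_sqr ler_wsqrtr// sqrrD !sqr_sqrtr//.
under eq_bigr do rewrite sqrrD.
rewrite !big_split/= -/A -/B lerD2r lerD2l mulr2n lerD//.
Qed.

(* Real-valued. The [normedModType R[i]] norm of [ell2] below is its image
   in [R[i]]. *)
Definition l2norm x := Num.sqrt (sqsum x).

Lemma l2norm_partial x n : x \in ell2_mem ->
  Num.sqrt (\sum_(0 <= k < n) normc (x k) ^+ 2) <= l2norm x.
Proof. by move=> xl2; rewrite ler_wsqrtr// sqsum_partial. Qed.

Lemma sum_normcD_le x y n : x \in ell2_mem -> y \in ell2_mem ->
  \sum_(0 <= k < n) normc (x k + y k) ^+ 2 <= (l2norm x + l2norm y) ^+ 2.
Proof.
move=> xl2 yl2.
have S0 : 0 <= \sum_(0 <= k < n) normc (x k + y k) ^+ 2.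
  by apply: sumr_ge0 => k _; rewrite sqr_ge0.
rewrite -(sqr_sqrtr S0) ler_sqr ?nnegrE ?addr_ge0 ?sqrtr_ge0//.
apply: (le_trans _ (lerD (l2norm_partial n xl2) (l2norm_partial n yl2))).
apply: (le_trans _ (sum_minkowski n _ _)); try by move=> k; exact: normc_nneg.
rewrite ler_wsqrtr//; apply: ler_sum => k _.
by rewrite ler_sqr ?nnegrE ?addr_ge0 ?normc_nneg// le_normcD.
Qed.

Lemma ell2_memZ (c : R[i]) x : x \in ell2_mem ->
  (fun k => c * x k) \in ell2_mem.
Proof.
move=> xl2; apply: (@ell2_mem_bounded _ (normc c ^+ 2 * sqsum x)) => n.
under eq_bigr do rewrite normcM exprMn.
by rewrite -mulr_sumr ler_wpM2l ?sqr_ge0// sqsum_partial.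
Qed.

Lemma ell2_submod_closed : submod_closed ell2_mem.
Proof.
split=> [|c x y xl2 yl2].
  apply: (@ell2_mem_bounded _ 0) => n; rewrite big1// => k _.
  by rewrite normc0 expr0n.
have cxl2 := ell2_memZ c xl2.
by apply: (@ell2_mem_bounded _ _) => n; exact: (sum_normcD_le n cxl2 yl2).
Qed.

HB.instance Definition _ :=
  GRing.isSubmodClosed.Build R[i] (nat -> R[i]) ell2_mem ell2_submod_closed.

Record ell2 := Ell2 { coord :> nat -> R[i]; _ : coord \in ell2_mem }.

HB.instance Definition _ := [isSub for coord].
HB.instance Definition _ := [Choice of ell2 by <:].
HB.instance Definition _ := [SubChoice_isSubLmodule of ell2 by <:].

Lemma l2normD (x y : ell2) : l2norm (x + y) <= l2norm x + l2norm y.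
Proof.
rewrite -[leRHS]ger0_norm ?addr_ge0 ?sqrtr_ge0// -sqrtr_sqr ler_wsqrtr//.
by apply: sqsum_le => n; exact: (sum_normcD_le n (valP x) (valP y)).
Qed.

Lemma l2normZ (c : R[i]) (x : ell2) : l2norm (c *: x) = normc c * l2norm x.
Proof.
rewrite /l2norm /sqsum -[X in X * _]ger0_norm ?normc_nneg// -sqrtr_sqr.
rewrite -sqrtrM ?sqr_ge0//; congr Num.sqrt.
have /ell2_memP cx := valP x.
have -> : series (fun k => normc ((c *: x) k) ^+ 2) =
    (fun n => normc c ^+ 2 * series (fun k => normc (x k) ^+ 2) n).
  apply/funext => n; rewrite /series/= mulr_sumr; apply: eq_bigr => k _.
  by rewrite -exprMn -normcM.
by apply/cvg_lim => //; apply: cvgM; [exact: cvg_cst|exact: cx].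
Qed.

Lemma l2norm_coord (x : ell2) n : normc (x n) <= l2norm x.
Proof.
apply: (le_trans _ (l2norm_partial n.+1 (valP x))).
rewrite -[leLHS]ger0_norm ?normc_nneg// -sqrtr_sqr ler_wsqrtr//.
by rewrite big_nat_recr//= lerDr sumr_ge0// => k _; rewrite sqr_ge0.
Qed.

Lemma ell2_ler_normD (x y : ell2) :
  (l2norm (x + y))%:C <= (l2norm x)%:C + (l2norm y)%:C :> R[i].
Proof. by rewrite -rmorphD/= lecR l2normD. Qed.

Lemma ell2_normrZ (c : R[i]) (x : ell2) :
  (l2norm (c *: x))%:C = `|c| * (l2norm x)%:C.
Proof. by rewrite l2normZ rmorphM; case: c. Qed.

Lemma ell2_normr0_eq0 (x : ell2) : (l2norm x)%:C = 0 :> R[i] -> x = 0.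
Proof.
move=> [x0]; apply/val_inj/funext => n /=; apply: eq0_normc; apply/eqP.
by rewrite eq_le normc_nneg -x0 l2norm_coord.
Qed.

HB.instance Definition _ := @Lmodule_isNormed.Build R[i] ell2
  (fun x : ell2 => (l2norm x)%:C) ell2_ler_normD ell2_normrZ ell2_normr0_eq0.

(* <x, y> = sum_k x_k conj(y_k), linear in the first argument. *)
Definition inner (x y : ell2) : R[i] :=
  limn (series (fun k => x k * (y k)^*)).

Lemma ell2_basis_subproof n : (fun k => (k == n)%:R) \in ell2_mem.
Proof.
apply: (@ell2_mem_bounded _ 1) => m.
rewrite (eq_bigr (fun k => if k == n then 1 else 0)); last first.
  by move=> k _; case: eqP; rewrite ?normc1 ?normc0 ?expr1n ?expr0n.
rewrite -big_mkcond/= big_mkord.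
case: (ltnP n m) => nm.
  by rewrite (big_pred1 (Ordinal nm))// => i; rewrite -val_eqE.
by rewrite big_pred0// => i; apply/negP => /eqP ni; move: (ltn_ord i); rewrite ni ltnNge nm.
Qed.

Definition ell2_basis n := Ell2 (ell2_basis_subproof n).

Lemma inner_ell2_basis (x : ell2) n : inner x (ell2_basis n) = x n.
Proof.
apply/cvg_lim; first exact: norm_hausdorff.
apply: cvg_near_cst; exists n.+1 => // m /= nm.
rewrite /series/= (bigD1_seq n) ?mem_index_iota ?iota_uniq//=.
rewrite eqxx mulr1n rmorph1 mulr1 big1 ?addr0// => k kn.
by rewrite (negPf kn) mulr0n rmorph0 mulr0.
Qed.

Definition unit_ball : set ell2 := [set x | `|x| < 1].

End Ell2.

Lemma near_differentiable (K : numFieldType) (V W : normedModType K)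
    (f g : V -> W) (x : V) :
  (\forall y \near x, f y = g y) -> differentiable f x -> differentiable g x.
Proof.
move=> fg df.
have fgx : f x = g x by exact: nbhs_singleton fg.
have gE : g \o shift x = cst (g x) + 'd f x +o_ 0 id.
  have /diff_locallyP[_ fE] := df.
  apply/eqaddoP => _/posnumP[e].
  move/eqaddoP: fE => /(_ _ (gt0 e)); apply: filter_app.
  move: fg; rewrite (near_shift 0) subr0; apply: filterS => y /= fgy.
  by rewrite !fctE/= fgy fgx.
have dE := diff_unique (diff_continuous df) gE.
by apply/diff_locallyP; rewrite dE; split=> //; exact: diff_continuous.
Qed.

Section Spectrum.
Variable R : realType.
Notation B := (@unit_ball R).

Lemma open_unit_ball : open B.
Proof.
rewrite (_ : B = ball (0 : ell2 R) 1) ?ball_open//.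
  by apply: ball_open.
by rewrite -ball_normE; apply/seteqP; split => x /=; rewrite sub0r normrN.
Qed.

Lemma valL_in (V : Type) (v : V) (f : B -> V) (x : B) : 'valL_ v f (\val x) = f x.
Proof. by have /= := congr1 (@^~ x) (valLK v f). Qed.

Lemma valLE (V : Type) (v : V) (f : B -> V) (x : ell2 R) (xB : x \in B) : 'valL_ v f x = f (exist _ x xB).
Proof. by rewrite -(valL_in v). Qed.

(* Complex Frechet differentiability at every point of the open ball. The value
   0 of the extension ['valL_ 0 f] outside the ball plays no role. *)
Definition holomorphic (V : normedModType R[i]) (f : B -> V) :=
  forall x : B, differentiable ('valL_ 0 f) (\val x).

(* [unif_continuous] is for the uniformity that the ball inherits from [ell2];
   [uc_epsP] below is the epsilon-delta form. *)
Definition Au_mem : {pred B -> R[i]} :=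
  mem [set f : B -> R[i] | holomorphic f /\ unif_continuous f].

Definition Hinf (V : normedModType R[i]) : set (B -> V) :=
  [set f | holomorphic f /\ bounded_fun f].

Definition Hinf_norm (g : B -> ell2 R) : R := sup (range (fun x => l2norm (g x))).

Lemma holo_near (V : normedModType R[i]) (f : B -> V) (F : ell2 R -> V) :
  (forall x : B, f x = F (\val x)) -> (forall x, x \in B -> differentiable F x) -> holomorphic f.
Proof.
move=> fF dF x; apply: (near_differentiable _ (dF _ (valP x))).
have : nbhs (\val x) B by apply: open_nbhs_nbhs; split; [exact: open_unit_ball|exact/set_mem/(valP x)].
apply: filterS => y /mem_set yB; by rewrite (valLE _ _ yB) fF.
Qed.

Lemma holo_cst (V : normedModType R[i]) (v : V) : holomorphic (fun _ : B => v).
Proof. by apply: (@holo_near _ _ (cst v)) => // x _; exact: differentiable_cst. Qed.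

Lemma valL_lift2 (V : zmodType) (op : V -> V -> V) (op0 : op 0 0 = 0) (f g : B -> V) :
  'valL_ 0 (fun x => op (f x) (g x)) = (fun x => op ('valL_ 0 f x) ('valL_ 0 g x)).
Proof.
by apply/funext => x; rewrite /valL_/=; case: ('oinv_set_val x).
Qed.

Lemma holoDZ (V : normedModType R[i]) (c : R[i]) (f g : B -> V) : holomorphic f -> holomorphic g ->
  holomorphic (c *: f + g).
Proof.
move=> hf hg x.
rewrite (_ : 'valL_ 0 _ = c *: 'valL_ 0 f + 'valL_ 0 g).
  by apply: differentiableD => //; apply: differentiableZ.
by rewrite [LHS](valL_lift2 (op := fun a b => c *: a + b))// scaler0 addr0.
Qed.

Lemma holoM (f g : B -> R[i]) : holomorphic f -> holomorphic g ->
  holomorphic (f * g).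
Proof.
move=> hf hg x.
rewrite (_ : 'valL_ 0 _ = 'valL_ 0 f * 'valL_ 0 g).
  by apply: differentiableM.
by rewrite [LHS](valL_lift2 (op := fun a b => a * b))// mulr0.
Qed.

Lemma normcR (c : R[i]) : `|c| = (normc c)%:C.
Proof. by case: c. Qed.

Lemma uc_epsP (f : B -> R[i]) : unif_continuous f <->
  forall e : R, 0 < e -> exists2 d : R, 0 < d & forall x y : B,
    l2norm (\val x - \val y) < d -> normc (f x - f y) < e.
Proof.
split=> [uf e e0|H E].
  have eC : 0 < e%:C :> R[i] by rewrite ltcR.
  have [D] := uf _ (entourage_ball _ (PosNum eC)).
  rewrite -entourage_ballE => -[[d1 d2] /= d0 dD] DE.
  move: d0 dD; rewrite ltcE/= => /andP[/eqP -> d0] dD.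
  exists d1 => // x y xy.
  have Dxy : D (\val x, \val y) by apply: dD; rewrite /= -ball_normE/= ltcR.
  by have := DE (x, y) Dxy; rewrite /= -ball_normE/= normcR ltcR.
rewrite -entourage_ballE => -[[e e2] /= e0 eE].
move: e0 eE; rewrite ltcE/= => /andP[/eqP -> e0] eE.
have [d d0 dH] := H _ e0.
exists [set xy | ball xy.1 (d%:C) xy.2].
  by rewrite -entourage_ballE; exists d%:C => //=; rewrite ltcR.
move=> [x y]/=; rewrite -ball_normE/= ltcR => /dH xy; apply: eE => /=.
by rewrite -ball_normE/= normcR ltcR.
Qed.

Lemma uc_bounded (f : B -> R[i]) : unif_continuous f -> exists M : R, forall x, normc (f x) <= M.
Proof.
move=> /uc_epsP /(_ 1 ltr01)[d d0 H].
have B0 : (0 : ell2 R) \in B by apply: mem_set; rewrite /unit_ball/= normr0.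
have BP (x : ell2 R) : x \in B <-> l2norm x < 1.
  have nx : (`|x| < 1) = (l2norm x < 1) by rewrite -ltcR.
  by split=> [/set_mem|xB]; [|apply/mem_set]; rewrite /unit_ball/= nx.
have nat_ub : exists N : nat, 1 < N.+1%:R * d.
  exists (Num.truncn d^-1).
  by rewrite -ltr_pdivrMr// mul1r truncnS_gt// ltW// invr_gt0.
have [N Nd] := nat_ub.
pose z : B := exist _ 0 B0.
suff key k (x : ell2 R) (xB : x \in B) : l2norm x < k.+1%:R * d ->
    normc (f (exist _ x xB) - f z) <= k.+1%:R.
  exists (N.+1%:R + normc (f z)) => -[x xB].
  rewrite -[f _](subrK (f z)); apply: (le_trans (le_normcD _ _)).
  rewrite lerD2r key//; apply: lt_trans Nd; exact/BP.
elim: k x xB => [|k IH] x xB xd.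
  by apply/ltW/H; rewrite /= subr0; move: xd; rewrite mul1r.
pose t : R := k.+1%:R / k.+2%:R.
have t0 : 0 <= t by rewrite divr_ge0.
have t1 : t <= 1 by rewrite ler_pdivrMr// mul1r ler_nat.
have nt : normc t%:C = t by rewrite /= expr0n addr0 sqrtr_sqr ger0_norm.
pose y := t%:C *: x.
have yn : l2norm y = t * l2norm x by rewrite l2normZ nt.
have x0 : 0 <= l2norm x by exact: sqrtr_ge0.
have yB : y \in B.
  by apply/BP; rewrite yn; apply: le_lt_trans (proj1 (BP x) xB); rewrite ler_piMl.
have yd : l2norm y < k.+1%:R * d.
  by rewrite yn /t mulrAC -mulrA ltr_pM2l// ltr_pdivrMr// [ltRHS]mulrC.
have xyE : x - y = (1 - t)%:C *: x.
  by rewrite /y rmorphB scalerBl scale1r.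
have n1t : normc (1 - t)%:C = 1 - t.
  by rewrite /= expr0n addr0 sqrtr_sqr ger0_norm// subr_ge0.
have xyd : l2norm (x - y) < d.
  rewrite xyE l2normZ n1t.
  have -> : 1 - t = k.+2%:R^-1.
    have k2 : k.+2%:R != 0 :> R by rewrite pnatr_eq0.
    apply: (mulIf k2); rewrite mulrBl mul1r divfK// mulVf//.
    by rewrite -natrB// subSn// subnn.
  by rewrite mulrC ltr_pdivrMr// mulrC.
rewrite -[f _](subrK (f (exist _ y yB))) -addrA.
apply: (le_trans (le_normcD _ _)); rewrite -[leRHS]natr1 [leRHS]addrC lerD ?IH//.
by apply/ltW/H.
Qed.

Lemma uc_DZ (c : R[i]) (f g : B -> R[i]) : unif_continuous f -> unif_continuous g ->
  unif_continuous (c *: f + g).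
Proof.
move=> /uc_epsP hf /uc_epsP hg; apply/uc_epsP => e e0.
have c0 : 0 < normc c + 1 by rewrite ltr_wpDl ?normc_nneg.
have [d1 d10 H1] := hf (e / 2 / (normc c + 1)) ltac:(by rewrite !divr_gt0).
have [d2 d20 H2] := hg (e / 2) ltac:(by rewrite !divr_gt0).
exists (Num.min d1 d2); first by rewrite lt_min d10.
move=> x y; rewrite lt_min => /andP[/H1 h1 /H2 h2].
rewrite !fctE/= (_ : _ - _ = c * (f x - f y) + (g x - g y)); last first.
  by rewrite mulrBr opprD addrACA.
apply: (le_lt_trans (le_normcD _ _)); rewrite normcM.
have : normc c * normc (f x - f y) <= e / 2.
  apply: (@le_trans _ _ ((normc c + 1) * (e / 2 / (normc c + 1)))).
    by apply: ler_pM; rewrite ?normc_nneg ?lerDl// ltW.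
  by rewrite mulrC divfK// gt_eqF.
by move: h2; lra.
Qed.

Lemma uc_M (f g : B -> R[i]) : unif_continuous f -> unif_continuous g ->
  unif_continuous (f * g).
Proof.
move=> uf ug; have [M fM] := uc_bounded uf; have [N gN] := uc_bounded ug.
move: uf ug => /uc_epsP hf /uc_epsP hg; apply/uc_epsP => e e0.
have fM1 x : normc (f x) <= `|M| + 1.
  by apply: (le_trans (fM x)); rewrite (le_trans (ler_norm _))// lerDl.
have gN1 x : normc (g x) <= `|N| + 1.
  by apply: (le_trans (gN x)); rewrite (le_trans (ler_norm _))// lerDl.
have M0 : 0 < `|M| + 1 by rewrite ltr_wpDl.
have N0 : 0 < `|N| + 1 by rewrite ltr_wpDl.
have [d1 d10 H1] := hf (e / 2 / (`|N| + 1)) ltac:(by rewrite !divr_gt0).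
have [d2 d20 H2] := hg (e / 2 / (`|M| + 1)) ltac:(by rewrite !divr_gt0).
exists (Num.min d1 d2); first by rewrite lt_min d10.
move=> x y; rewrite lt_min => /andP[/H1 h1 /H2 h2].
rewrite !fctE/= (_ : _ - _ = g x * (f x - f y) + f y * (g x - g y)); last by ring.
apply: (le_lt_trans (le_normcD _ _)); rewrite !normcM.
have : normc (g x) * normc (f x - f y) < e / 2.
  apply: (@le_lt_trans _ _ ((`|N| + 1) * normc (f x - f y))).
    by rewrite ler_wpM2r ?normc_nneg.
  by rewrite mulrC -ltr_pdivlMr.
have : normc (f y) * normc (g x - g y) < e / 2.
  apply: (@le_lt_trans _ _ ((`|M| + 1) * normc (g x - g y))).
    by rewrite ler_wpM2r ?normc_nneg.
  by rewrite mulrC -ltr_pdivlMr.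
by lra.
Qed.

Lemma Au_submod_closed : submod_closed Au_mem.
Proof.
split.
  apply: mem_set; split; first exact: holo_cst.
  by apply/uc_epsP => e e0; exists 1 => // x y _; rewrite subrr normc0.
move=> c f g /set_mem[hf uf] /set_mem[hg ug]; apply: mem_set; split.
  exact: holoDZ. exact: uc_DZ.
Qed.

Lemma Au_subring_closed : subring_closed Au_mem.
Proof.
split.
- apply: mem_set; split; first exact: holo_cst.
  by apply/uc_epsP => e e0; exists 1 => // x y _; rewrite subrr normc0.
- move=> f g fA gA; have [_ H] := Au_submod_closed.
  by have := H (-1) _ _ gA fA; rewrite scaleN1r addrC.
- move=> f g /set_mem[hf uf] /set_mem[hg ug]; apply: mem_set; split.
    exact: holoM.
  exact: uc_M.
Qed.

HB.instance Definition _ :=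
  GRing.isSubringClosed.Build (B -> R[i]) Au_mem Au_subring_closed.
HB.instance Definition _ :=
  GRing.isSubmodClosed.Build R[i] (B -> R[i]) Au_mem Au_submod_closed.

Record Au := MkAu { Au_fun :> B -> R[i]; _ : Au_fun \in Au_mem }.

HB.instance Definition _ := [isSub for Au_fun].
HB.instance Definition _ := [Choice of Au by <:].
HB.instance Definition _ :=
  GRing.SubChoice_isSubComPzRing.Build _ _ Au (subringClosedP _).
HB.instance Definition _ := [SubZmodule_isSubLmodule of Au by <:].

(* The continuous extension of [f] to the closed ball: the limit at [z] along
   the open ball, an arbitrary value when [z] is not in the closed ball. *)
Definition Au_ext (f : Au) (z : ell2 R) : R[i] :=
  lim ('valL_ 0 f y @[y --> within B (nbhs z)]).

Section coord.
Variable n : nat.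
Definition coordn (x : ell2 R) : R[i] := x n.
Lemma coordn_linear : linear coordn. Proof. by []. Qed.
HB.instance Definition _ := GRing.isLinear.Build R[i] (ell2 R) R[i] *:%R coordn coordn_linear.
Lemma coordn_continuous : continuous coordn.
Proof.
move=> x; apply/(@cvgrPdist_lt _ _ _ (nbhs x)) => e e0.
apply: filterS (nbhsx_ballx x e e0) => y; rewrite -ball_normE/=.
apply: le_lt_trans; rewrite -linearB/= normcR lecR.
exact: (l2norm_coord (x - y) n).
Qed.

End coord.

Lemma pairing_subproof n : (fun x : B => inner (\val x) (ell2_basis R n)) \in Au_mem.
Proof.
apply: mem_set; split.
  apply: (@holo_near _ _ (coordn n)); first by move=> x; rewrite inner_ell2_basis.
  by move=> x _; apply: linear_differentiable; exact: coordn_continuous.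
apply/uc_epsP => e e0; exists e => // x y; rewrite !inner_ell2_basis.
by apply: le_lt_trans; exact: (l2norm_coord (\val x - \val y) n).
Qed.

Definition pairing n : Au := MkAu (pairing_subproof n).

(* Nonzero algebra homomorphisms from A_u to H^oo, given as maps into all
   functions on the ball with values in the subalgebra H^oo. Preservation of
   units is not required. *)
Definition spectrum_u_inf : set (Au -> B -> R[i]) :=
  [set Phi : Au -> B -> R[i] |
    [/\ linear Phi, {morph Phi : f h / f * h},
        exists f, Phi f != 0 & forall f, Hinf (Phi f)]].

(* The values are kept as coordinate sequences, so that no square summability
   has to be established to write [xi Phi]; [fiber] compares them with the
   coordinates of [g]. *)
Definition xi (Phi : Au -> B -> R[i]) : B -> nat -> R[i] :=
  fun x n => Phi (pairing n) x.

Definition fiber (g : B -> ell2 R) : set (Au -> B -> R[i]) :=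
  [set Phi | spectrum_u_inf Phi /\ xi Phi = (fun x => coord (g x))].

(* Meaningful when [g] takes values in the closed unit ball. *)
Definition comp_hom (g : B -> ell2 R) : Au -> B -> R[i] :=
  fun f x => Au_ext f (g x).

End Spectrum.

(* Main.v *)
(** For each [x] in the ball, [f |-> Phi f x] is a character [phi] of [A_u] with
    [phi (pairing k) = z k], where [z], of norm [1], is the value of [g]. The
    values of a character are bounded by the sup norm, since [c - f] is
    invertible in [A_u] when [|c| > ||f||]. In the Hilbert ball, the functions
    [(1 + <., z>) / 2] peak at [z] only: their modulus stays away from [1] off
    each neighbourhood of [z], while their image under [phi] is [1]. Multiplying
    [f - f(z)] by a high power of such a function makes it uniformly small
    without changing its image under [phi], so that [phi f = f(z)]. Replacing
    [<., z>] by its finite partial sums, one needs the linearity of [phi] only,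
    and [phi] takes values close to [1]. *)

From HB Require Import structures.
Require Import Defs.
From mathcomp Require Import all_boot all_order all_algebra complex.
From mathcomp Require Import all_classical all_reals all_analysis.
From mathcomp Require Import ring lra.
Import Order.TTheory GRing.Theory Num.Theory numFieldNormedType.Exports.
Import Normc.
Local Open Scope classical_set_scope.
Local Open Scope ring_scope.

(** * Completeness of the complex numbers *)

Lemma Re_le_normc {R : realType} (c : R[i]) : `|complex.Re c| <= normc c.
Proof. by have := normc_ge_Re c; rewrite normcR lecR. Qed.

Lemma Im_le_normc {R : realType} (c : R[i]) : `|complex.Im c| <= normc c.
Proof.
by case: c => a b /=; rewrite -sqrtr_sqr ler_wsqrtr// lerDr sqr_ge0.
Qed.

Lemma normc_le_ReIm {R : realType} (c : R[i]) :
  normc c <= `|complex.Re c| + `|complex.Im c|.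
Proof.
case: c => a b /=; rewrite -[leRHS]ger0_norm ?addr_ge0//.
rewrite -sqrtr_sqr ler_wsqrtr// sqrrD !real_normK ?num_real//.
by rewrite addrAC lerDl mulrn_wge0// mulr_ge0.
Qed.

(** Real and imaginary parts do not increase distances, so both image filters are Cauchy in [R], and
    their limits are the two parts of [l]. *)
Lemma complex_cauchy_cvg {R : realType} (F : set_system R[i]) :
  ProperFilter F ->
  (forall e : R, 0 < e -> exists c, F [set w | normc (c - w) < e]) ->
  exists l : R[i], F --> l.
Proof.
move=> PF Fcauchy.
have part_cvg (p : R[i] -> R) : (forall c w, p c - p w = p (c - w)) ->
    (forall c, `|p c| <= normc c) -> exists a : R, p x @[x --> F] --> a.
  move=> pB p_le; exists (lim (p x @[x --> F])).
  apply/(@cauchy_cvgP R); apply: (@cauchy_exP _ R (p x @[x --> F])) => e e0.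
  have [c Fc] := Fcauchy e e0.
  exists (p c).
  suff : F [set w | ball (p c) e (p w)] by [].
  apply: filterS Fc => w /= cw.
  by rewrite -ball_normE /ball_/= pB (le_lt_trans (p_le _)).
have ReB (c w : R[i]) : complex.Re c - complex.Re w = complex.Re (c - w).
  by case: c w => ? ? [].
have ImB (c w : R[i]) : complex.Im c - complex.Im w = complex.Im (c - w).
  by case: c w => ? ? [].
have [a Fa] := part_cvg _ ReB Re_le_normc.
have [b Fb] := part_cvg _ ImB Im_le_normc.
exists (Complex a b); apply/(@cvgrPdist_lt _ _ _ F) => e.
(* A positive element of [R[i]] is real, so [e] may be taken in [R]. *)
rewrite ltcE/= => /andP[/eqP]; case: e => e _ /= -> e0.
have /cvgrPdist_lt/(_ _ (divr_gt0 e0 (ltr0n _ 2)))Ha := Fa.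
have /cvgrPdist_lt/(_ _ (divr_gt0 e0 (ltr0n _ 2)))Hb := Fb.
apply: filterS2 Ha Hb => w Hw1 Hw2; rewrite normcR ltcR; apply: (le_lt_trans (normc_le_ReIm _)).
rewrite -ReB -ImB/= [e]splitr; exact: ltrD.
Qed.

(** * The continuous extension to the closed ball *)

Lemma unit_ballE {R : realType} (x : ell2 R) :
  (x \in @unit_ball R) = (l2norm x < 1).
Proof.
have nx : (`|x| < 1) = (l2norm x < 1) by rewrite -ltcR.
by apply/idP/idP => [/set_mem|xB]; [|apply/mem_set]; rewrite /unit_ball/= nx.
Qed.

Lemma mem0_unit_ball {R : realType} : (0 : ell2 R) \in @unit_ball R.
Proof. by rewrite mem_set// /unit_ball/= normr0. Qed.

(** A point of the closed ball is approached from inside by [(1 - t) z] as [t > 0] tends to [0].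
    This makes limits along the ball unique. *)
Lemma within_unit_ball_proper {R : realType} (z : ell2 R) : l2norm z <= 1 ->
  ProperFilter (within (@unit_ball R) (nbhs z)).
Proof.
move=> z1; apply: within_nbhs_proper => A /nbhs_ballP[d].
rewrite /= ltcE/= => /andP[/eqP]; case: d => d _ /= -> d0 dA.
pose t := Num.min (d / 2) (1 / 2).
have t0 : 0 < t by rewrite lt_min !divr_gt0.
have td : t < d by rewrite gt_min; apply/orP; left; lra.
have t1 : t < 1 by rewrite gt_min; apply/orP; right; lra.
exists ((1 - t)%:C%C *: z); split.
  apply/set_mem; rewrite unit_ballE l2normZ /= expr0n addr0 sqrtr_sqr.
  rewrite ger0_norm ?subr_ge0 ?ltW//.
  have : 0 <= l2norm z by exact: sqrtr_ge0.
  by nra.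
apply: dA; rewrite -ball_normE/= ltcR.
rewrite (_ : z - _ = t%:C%C *: z); last first.
  by rewrite rmorphB scalerBl scale1r opprB addrC subrK.
rewrite l2normZ /= expr0n addr0 sqrtr_sqr gtr0_norm//.
by have := sqrtr_ge0 (sqsum z); rewrite -/(l2norm z); nra.
Qed.

Lemma within_unit_ballP {R : realType} (z : ell2 R) (A : set (ell2 R)) :
  within (@unit_ball R) (nbhs z) A <->
  exists2 d : R, 0 < d &
    forall x : @unit_ball R, l2norm (z - \val x) < d -> A (\val x).
Proof.
split=> [/nbhs_ballP[d]|[d d0 dA]].
  rewrite /= ltcE/= => /andP[/eqP]; case: d => d _ /= -> d0 dA.
  exists d => // x zx; apply: dA; last exact/set_mem/(valP x).
  by rewrite -ball_normE/= ltcR.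
apply/nbhs_ballP; exists d%:C%C; first by rewrite /= ltcR.
move=> x; rewrite -ball_normE/= ltcR => zx /mem_set xB.
exact: (dA (exist _ x xB)).
Qed.

(** Two points of the ball within [d / 2] of [z] are within [d] of each other, so uniform continuity
    makes the image filter Cauchy. *)
Lemma Au_ext_cvg {R : realType} (f : Au R) (z : ell2 R) : l2norm z <= 1 ->
  'valL_ 0 f y @[y --> within (@unit_ball R) (nbhs z)] --> Au_ext f z.
Proof.
move=> z1; have PF := within_unit_ball_proper z z1.
suff : cvg ('valL_ 0 f y @[y --> within (@unit_ball R) (nbhs z)]) by [].
apply/cvg_ex; apply: complex_cauchy_cvg => e e0.
have [_ /uc_epsP/(_ e e0)[d d0 fd]] := set_mem (valP f).
have Fz : within (@unit_ball R) (nbhs z) [set y | l2norm (z - y) < d / 2].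
  by apply/within_unit_ballP; exists (d / 2) => //; exact: divr_gt0.
have FB : within (@unit_ball R) (nbhs z) (@unit_ball R).
  by apply/within_unit_ballP; exists 1 => // x _; exact/set_mem/(valP x).
have [y [zy /mem_set yB]] := filter_ex (filterI Fz FB).
pose yb : @unit_ball R := exist _ y yB.
exists (f yb); apply/within_unit_ballP; exists (d / 2); first exact: divr_gt0.
move=> x zx; suff : normc (f yb - 'valL_ 0 f (\val x)) < e by [].
rewrite valL_in; apply: fd.
rewrite (_ : \val yb - _ = (z - \val x) + (- 1) *: (z - y)); last first.
  by rewrite scaleN1r opprB [RHS]addrC addrA subrK.
apply: (le_lt_trans (l2normD _ _)); rewrite l2normZ normcN normc1 mul1r.
by rewrite /= in zy; lra.
Qed.

(** * Boundedness of characters *)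

(** The modulus of [c - f] is at least [normc c - e > 0], which keeps the reciprocal uniformly
    continuous as well as holomorphic. *)
Lemma Au_resolvent {R : realType} (f : Au R) (c : R[i]) (e : R) :
  (forall x, normc (f x) <= e) -> e < normc c ->
  exists h : Au R, (c *: (1 : Au R) - f) * h = 1.
Proof.
move=> fe ec; pose r : R := normc c - e.
have r0 : 0 < r by rewrite subr_gt0.
have r_le x : r <= normc (c - f x).
  have := le_normcD (c - f x) (f x); rewrite subrK.
  by have := fe x; rewrite /r; lra.
have cf0 x : c - f x != 0.
  by apply/eqP => cf; have := r_le x; rewrite cf normc0; lra.
pose k (x : @unit_ball R) := (c - f x)^-1.
have [hf /uc_epsP uf] := set_mem (valP f).
have kA : k \in @Au_mem R.
  apply: mem_set; split.
    apply: (@holo_near _ _ _ (fun y => (c - 'valL_ 0 f y)^-1)) => [x|x xB].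
      by rewrite valL_in.
    apply: differentiableV.
      by apply: differentiableB; [exact: differentiable_cst|exact: (hf (exist _ x xB))].
    by rewrite (valLE _ _ xB) cf0.
  (* The difference of two reciprocals is [f x - f y] divided by two factors of modulus at least
     [r], whence the tolerance [d * r ^+ 2]. *)
  apply/uc_epsP => d d0; have dr0 : 0 < d * r ^+ 2 by rewrite mulr_gt0 ?exprn_gt0.
  have [d1 d10 H] := uf _ dr0.
  exists d1 => // x y xy.
  have -> : k x - k y = (f x - f y) * (c - f x)^-1 * (c - f y)^-1.
    by rewrite /k; field; rewrite !cf0.
  rewrite !normcM !normcV -mulrA -invfM ltr_pdivrMr; last first.
    by rewrite mulr_gt0 ?(lt_le_trans r0).
  apply: (lt_le_trans (H _ _ xy)); rewrite ler_pM2l//.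
  by rewrite expr2 ler_pM// ?r_le// ltW.
exists (MkAu kA); apply/val_inj/funext => x /=.
suff : (c * 1 - f x) * (c - f x)^-1 = 1 by [].
by rewrite mulr1 divff.
Qed.

(** Otherwise [phi f - f] would be invertible, although [phi] sends it to [0]. *)
Lemma character_le {R : realType} (phi : {linear Au R -> R[i]}) (f : Au R)
    (e : R) :
  {morph phi : u v / u * v} -> phi 1 = 1 ->
  (forall x, normc (f x) <= e) -> normc (phi f) <= e.
Proof.
move=> phiM phi1 fe; rewrite leNgt; apply/negP => ef.
have [h fh] := Au_resolvent f _ _ fe ef.
have := congr1 phi fh; rewrite phiM phi1 linearB linearZ/= phi1 [_ *: 1]mulr1.
by rewrite subrr mul0r => /eqP; rewrite eq_sym oner_eq0.
Qed.

(** * Peak functions and their images under a character *)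

Definition partial_inner {R : realType} (z : ell2 R) n : Au R :=
  \sum_(0 <= k < n) (z k)^*%C *: pairing R k.

Lemma partial_innerE {R : realType} (z : ell2 R) n (x : @unit_ball R) :
  partial_inner z n x = \sum_(0 <= k < n) (z k)^*%C * (\val x : ell2 R) k.
Proof.
elim: n => [|n IH]; first by rewrite /partial_inner !big_nil.
rewrite [RHS]big_nat_recr//= -IH /partial_inner big_nat_recr//=.
by rewrite -(inner_ell2_basis (\val x) n).
Qed.

Lemma normc_conjc {R : realType} (c : R[i]) : normc c^*%C = normc c.
Proof. by case: c => a b /=; rewrite sqrrN. Qed.

Lemma sqsum_le1 {R : realType} (y : ell2 R) n :
  l2norm y <= 1 -> \sum_(0 <= k < n) normc (y k) ^+ 2 <= 1.
Proof.
move=> y1; rewrite (le_trans (sqsum_partial n (valP y)))//.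
by rewrite -[sqsum _]sqr_sqrtr ?sqsum_ge0 ?(valP y)// expr_le1 ?sqrtr_ge0.
Qed.

Lemma partial_inner_le1 {R : realType} (z : ell2 R) n (x : @unit_ball R) :
  l2norm z <= 1 -> normc (partial_inner z n x) <= 1.
Proof.
move=> z1; rewrite partial_innerE.
have xB : l2norm (\val x : ell2 R) < 1 by rewrite -unit_ballE (valP x).
apply: (@le_trans _ _ (\sum_(0 <= k < n) normc ((z k)^*%C * (\val x : ell2 R) k))).
  elim: n => [|n IH]; first by rewrite !big_nil normc0.
  by rewrite !big_nat_recr//= (le_trans (le_normcD _ _))// lerD.
apply: (@le_trans _ _ ((\sum_(0 <= k < n) normc (z k) ^+ 2 +
    \sum_(0 <= k < n) normc ((\val x : ell2 R) k) ^+ 2) / 2)).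
  (* AM-GM: [|z k| |x k| <= (|z k|^2 + |x k|^2) / 2] *)
  rewrite -big_split/= mulr_suml; apply: ler_sum => k _.
  rewrite normcM normc_conjc.
  by have := sqr_ge0 (normc (z k) - normc ((\val x : ell2 R) k)); lra.
have := sqsum_le1 z n z1; have := sqsum_le1 _ n (ltW xB); lra.
Qed.

Lemma sqr_normc_ReIm {R : realType} (c : R[i]) :
  normc c ^+ 2 = complex.Re c ^+ 2 + complex.Im c ^+ 2.
Proof. by case: c => a b /=; rewrite sqr_sqrtr// addr_ge0 ?sqr_ge0. Qed.

(** With the full inner product, expanding the square gives the bound [2 (1 - Re <x, z>)]; doubling
    the constant makes it survive truncation at every [n]. *)
Lemma dist_partial_inner {R : realType} (z : ell2 R) n (x : @unit_ball R) :
  l2norm z <= 1 ->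
  l2norm (\val x - z) ^+ 2 <= 4 * (1 - complex.Re (partial_inner z n x)).
Proof.
move=> z1; rewrite partial_innerE.
have x1 : l2norm (\val x : ell2 R) <= 1 by rewrite ltW// -unit_ballE (valP x).
move: {x} (\val x : ell2 R) x1 => x x1.
rewrite sqr_sqrtr ?sqsum_ge0 ?(valP (x - z))//.
apply: sqsum_le => N; rewrite -[(x - z : nat -> _)]/(fun k => x k - z k).
(* Summing up to [n + N] covers all the indices of the truncated inner product. *)
apply: (@le_trans _ _ (\sum_(0 <= k < n + N) normc (x k - z k) ^+ 2)).
  rewrite addnC [leRHS](big_cat_nat (leq0n N) (leq_addr n N))/= lerDl.
  by apply: sumr_ge0 => k _; rewrite sqr_ge0.
(* The factor [2] absorbs the cross terms of index at least [n]. *)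
have : \sum_(0 <= k < n + N) normc (x k - z k) ^+ 2 <=
    2 * (\sum_(0 <= k < n + N) normc (x k) ^+ 2 +
         \sum_(0 <= k < n + N) normc (z k) ^+ 2) -
    4 * complex.Re (\sum_(0 <= k < n) (z k)^*%C * x k).
  elim: N => [|N IH].
    rewrite addn0; elim: n => [|n IH]; first by rewrite !big_nil/=; lra.
    rewrite !big_nat_recr//= !raddfD/=.
    have : normc (x n - z n) ^+ 2 <= 2 * (normc (x n) ^+ 2 + normc (z n) ^+ 2) -
        4 * complex.Re ((z n)^*%C * x n).
      rewrite !sqr_normc_ReIm; case: (x n) (z n) => [a b] [c d] /=.
      by have := sqr_ge0 (a - c); have := sqr_ge0 (b - d); nra.
    by move: IH; lra.
  rewrite addnS !big_nat_recr//=.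
  have : normc (x (n + N)%N - z (n + N)%N) ^+ 2 <=
      2 * (normc (x (n + N)%N) ^+ 2 + normc (z (n + N)%N) ^+ 2).
    rewrite !sqr_normc_ReIm; case: (x _) (z _) => [a b] [c d] /=.
    by have := sqr_ge0 (a + c); have := sqr_ge0 (b + d); nra.
  by move: IH; lra.
have := sqsum_le1 x (n + N) x1; have := sqsum_le1 z (n + N) z1; lra.
Qed.

Definition peak {R : realType} (z : ell2 R) n : Au R :=
  (2^-1 : R[i]) *: (1 + partial_inner z n).

Lemma normc_real {R : realType} (a : R) : 0 <= a -> normc a%:C%C = a.
Proof. by move=> a0; rewrite /= expr0n addr0 sqrtr_sqr ger0_norm. Qed.

(** For [|w| <= 1], [|1 + w|^2 / 4 <= (1 + Re w) / 2 = 1 - (1 - Re w) / 2], and [1 - Re w] is at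
    least a quarter of the squared distance to [z]. *)
Lemma sqr_normc_peak {R : realType} (z : ell2 R) n (x : @unit_ball R) :
  l2norm z <= 1 ->
  normc (peak z n x) ^+ 2 <= 1 - l2norm (\val x - z) ^+ 2 / 8.
Proof.
move=> z1; have := dist_partial_inner z n x z1.
have := partial_inner_le1 z n x z1.
have -> : peak z n x = 2^-1 * (1 + partial_inner z n x) by [].
rewrite normcM exprMn normcV.
rewrite -[2](rmorph_nat (real_complex R) 2) normc_real// sqr_normc_ReIm.
move=> p1; have : normc (partial_inner z n x) ^+ 2 <= 1 by rewrite expr_le1// normc_nneg.
rewrite sqr_normc_ReIm; case: (partial_inner z n x) => a b /=.
by rewrite add0r; nra.
Qed.

(** The truncated inner product is sent to the sum of the [(z k)^* * z k]; for a unit vector [z] the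
    value thus tends to [1] as [n] grows. *)
Lemma character_peak {R : realType} (phi : {linear Au R -> R[i]}) (z : ell2 R) n :
  phi 1 = 1 -> (forall k, phi (pairing R k) = z k) ->
  phi (peak z n) = ((1 + \sum_(0 <= k < n) normc (z k) ^+ 2) / 2)%:C%C.
Proof.
move=> phi1 phiz.
have phip : phi (partial_inner z n) = (\sum_(0 <= k < n) normc (z k) ^+ 2)%:C%C.
  elim: n => [|n IH]; first by rewrite /partial_inner !big_nil linear0.
  rewrite big_nat_recr//= rmorphD/= -IH /partial_inner big_nat_recr//=.
  rewrite linearD linearZ/= phiz; congr (_ + _).
  rewrite -[_ *: _]/((z n)^*%C * z n).
  by rewrite mulrC -sqr_normc normcR rmorphXn.
rewrite /peak linearZ linearD/= phi1 phip.
rewrite -[_ *: _]/(2^-1 * (1 + _ : R[i])).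
by rewrite mulrC rmorphM/= fmorphV rmorphD/= rmorph1 rmorph_nat.
Qed.

(** * Localization of characters at [z] *)

(** Multiplying [u] by [peak z n ^+ m.*2] keeps it at most [e] near [z] and brings it below [e]
    elsewhere, so [character_le] applies to the product. The image of the extra factor tends to [1]
    with [n]. *)
Lemma character_local {R : realType} (phi : {linear Au R -> R[i]}) (z : ell2 R)
    (u : Au R) (e d : R) :
  {morph phi : u v / u * v} -> phi 1 = 1 ->
  l2norm z = 1 -> (forall k, phi (pairing R k) = z k) ->
  0 < e -> 0 < d ->
  (forall x : @unit_ball R, l2norm (\val x - z) < d -> normc (u x) <= e) ->
  normc (phi u) <= e.
Proof.
move=> phiM phi1 z1 phiz e0 d0 ue.
have z1' : l2norm z <= 1 by rewrite z1.
(* [q] bounds the squared modulus of every peak at distance at least [d] from [z]; the maximum keeps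
   it nonnegative for large [d]. Being independent of [n], it lets [m] be fixed before [n] grows. *)
pose q := Num.max 0 (1 - d ^+ 2 / 8).
have q0 : 0 <= q by rewrite le_max lexx.
have q1 : q < 1 by rewrite gt_max ltr01/= ltrBlDr ltrDl divr_gt0 ?exprn_gt0.
have [_ /uc_bounded[M uM]] := set_mem (valP u).
have [m qm] : exists m, M * q ^+ m <= e.
  have : M * q ^+ m @[m --> \oo] --> (0 : R).
    rewrite -(mulr0 M); apply: cvgMr; apply: cvg_expr.
    by rewrite ger0_norm.
  move=> /cvgrPdist_lt/(_ _ e0)[m _ /(_ m (leqnn m))].
  rewrite /= sub0r normrN => /ltW qm; exists m.
  exact: le_trans (ler_norm _) qm.
have phiX (h : Au R) k : phi (h ^+ k) = phi h ^+ k.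
  by elim: k => [|k IH]; rewrite ?expr0// !exprS phiM IH.
pose s n : R := \sum_(0 <= k < n) normc (z k) ^+ 2.
have s0 n : 0 <= s n by apply: sumr_ge0 => k _; rewrite sqr_ge0.
(* The exponent is even because the peak estimate concerns the squared modulus. *)
have bound n : normc (phi u) * ((1 + s n) / 2) ^+ (m.*2) <= e.
  rewrite -[(1 + s n) / 2]normc_real ?divr_ge0 ?addr_ge0//.
  have normcX (c : R[i]) k : normc c ^+ k = normc (c ^+ k).
    by elim: k => [|k IH]; rewrite ?expr0 ?normc1// !exprS normcM IH.
  rewrite /s -(character_peak phi z n phi1 phiz) normcX -phiX -normcM -phiM.
  apply: character_le => // x.
  have AuX (h : Au R) k : (h ^+ k) x = h x ^+ k.
    by elim: k => [|k IH]; rewrite ?expr0// !exprS -IH.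
  have -> : (u * peak z n ^+ m.*2) x = u x * (peak z n x) ^+ m.*2 by rewrite -AuX.
  rewrite normcM -normcX -mul2n exprM.
  have pk := sqr_normc_peak z n x z1'.
  have [xd|dx] := ltP (l2norm (\val x - z)) d.
    rewrite -[leRHS]mulr1 ler_pM ?exprn_ge0 ?ue ?normc_nneg//.
    rewrite exprn_ile1 ?sqr_ge0// (le_trans pk)//.
    by have := sqr_ge0 (l2norm (\val x - z)); lra.
  apply: le_trans qm; rewrite ler_pM ?exprn_ge0 ?uM ?normc_nneg//.
  rewrite lerXn2r ?nnegrE ?sqr_ge0// le_max; apply/orP; right; apply: le_trans pk _.
  have : d ^+ 2 <= l2norm (\val x - z) ^+ 2 by rewrite ler_sqr ?nnegrE ?sqrtr_ge0// ltW.
  by lra.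
have slim : s n @[n --> \oo] --> (1 : R).
  have := valP z => /ell2_memP; rewrite -/s.
  have -> : (1 : R) = sqsum z.
    by rewrite -[sqsum z]sqr_sqrtr ?sqsum_ge0 ?(valP z)// [Num.sqrt _]z1 expr1n.
  exact.
have : normc (phi u) * ((1 + s n) / 2) ^+ m.*2 @[n --> \oo] --> normc (phi u).
  rewrite -[X in _ --> X]mulr1; apply: cvgMr.
  rewrite -[X in _ --> X](expr1n _ m.*2).
  apply: (continuous_cvg _ (h := fun t : R => t ^+ m.*2)); first exact: exprn_continuous.
  rewrite [X in _ --> X](_ : _ = (1 + 1) / 2); last by lra.
  by apply: cvgMl; apply: cvgD => //; exact: cvg_cst.
move=> /cvgr_to_le; apply; exact: nearW.
Qed.

(** * Evaluation at a point of the closed ball *)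

Lemma Au_ext_unique {R : realType} (f : Au R) (z : ell2 R) (l : R[i]) :
  l2norm z <= 1 ->
  'valL_ 0 f y @[y --> within (@unit_ball R) (nbhs z)] --> l ->
  Au_ext f z = l.
Proof.
move=> z1; have PF := within_unit_ball_proper z z1.
exact: (cvg_lim (@norm_hausdorff _ _)).
Qed.

Lemma within_unit_ball_cvgP {R : realType} (f : Au R) (z : ell2 R) (l : R[i]) :
  'valL_ 0 f y @[y --> within (@unit_ball R) (nbhs z)] --> l <->
  forall e : R, 0 < e -> exists2 d : R, 0 < d &
    forall x : @unit_ball R, l2norm (z - \val x) < d -> normc (l - f x) < e.
Proof.
split=> [/cvgrPdist_lt fl e e0|fl].
  have eC : 0 < e%:C%C :> R[i] by rewrite ltcR.
  have /within_unit_ballP[d d0 H] := fl _ eC.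
  exists d => // x /H fx; have {fx} : `|l - 'valL_ 0 f (\val x)| < e%:C%C := fx.
  by rewrite valL_in normcR ltcR.
apply/cvgrPdist_lt => e.
rewrite ltcE/= => /andP[/eqP]; case: e => e _ /= -> e0.
apply/within_unit_ballP; have [d d0 H] := fl e e0.
exists d => // x /H fx; suff : `|l - 'valL_ 0 f (\val x)| < e%:C%C by [].
by rewrite valL_in normcR ltcR.
Qed.

Lemma Au_ext1 {R : realType} (z : ell2 R) : l2norm z <= 1 -> Au_ext 1 z = 1.
Proof.
move=> z1; apply: Au_ext_unique => //; apply/within_unit_ball_cvgP => e e0.
by exists 1 => // x _; rewrite subrr normc0.
Qed.

Lemma Au_ext_pairing {R : realType} (z : ell2 R) n :
  l2norm z <= 1 -> Au_ext (pairing R n) z = z n.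
Proof.
move=> z1; apply: Au_ext_unique => //; apply/within_unit_ball_cvgP => e e0.
exists e => // x; apply: le_lt_trans.
rewrite -[pairing R n x]/(inner (\val x) (ell2_basis R n)) inner_ell2_basis.
exact: (l2norm_coord (z - \val x) n).
Qed.

Lemma Au_extDZ {R : realType} (c : R[i]) (f h : Au R) (z : ell2 R) :
  l2norm z <= 1 -> Au_ext (c *: f + h) z = c * Au_ext f z + Au_ext h z.
Proof.
move=> z1; apply: Au_ext_unique => //.
have -> : 'valL_ 0 (c *: f + h : Au R) = (fun y => c * 'valL_ 0 f y + 'valL_ 0 h y).
  rewrite -(valL_lift2 (op := fun a b => c * a + b))//.
  by rewrite mulr0 addr0.
have PF := within_unit_ball_proper z z1.
by apply: cvgD; [apply: cvgMr|]; exact: Au_ext_cvg.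
Qed.

Lemma Au_extM {R : realType} (f h : Au R) (z : ell2 R) :
  l2norm z <= 1 -> Au_ext (f * h) z = Au_ext f z * Au_ext h z.
Proof.
move=> z1; apply: Au_ext_unique => //.
have -> : 'valL_ 0 (f * h : Au R) = (fun y => 'valL_ 0 f y * 'valL_ 0 h y).
  by rewrite -(valL_lift2 (op := fun a b => a * b))// mulr0.
have PF := within_unit_ball_proper z z1.
by apply: cvgM; exact: Au_ext_cvg.
Qed.

Lemma comp_hom_fiber {R : realType} (z : ell2 R) :
  l2norm z <= 1 -> fiber (fun _ => z) (comp_hom (fun _ : @unit_ball R => z)).
Proof.
move=> z1; split; last by apply/funext => x; apply/funext => n; exact: Au_ext_pairing.
split.
- by move=> c f h; apply/funext => x; exact: Au_extDZ.
- by move=> f h; apply/funext => x; exact: Au_extM.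
- exists 1; apply/eqP => /(congr1 (@^~ (exist _ 0 mem0_unit_ball))).
  by rewrite /comp_hom Au_ext1// => /eqP; rewrite oner_eq0.
- move=> f; split; first exact: holo_cst.
  exists `|Au_ext f z|; split; first exact: normr_real.
  by move=> M zM x _; exact: ltW.
Qed.

(** * Determination of the fiber *)

(** [f - Au_ext f z] is at most [e] near [z], so localization bounds its image by every [e > 0]. *)
Lemma character_eq_ext {R : realType} (phi : {linear Au R -> R[i]}) (z : ell2 R)
    (f : Au R) :
  {morph phi : u v / u * v} -> phi 1 = 1 ->
  l2norm z = 1 -> (forall k, phi (pairing R k) = z k) ->
  phi f = Au_ext f z.
Proof.
move=> phiM phi1 z1 phiz; apply/eqP; rewrite -subr_eq0; apply/eqP/eq0_normc/eqP.
rewrite eq_le normc_nneg andbT; apply/ler_addgt0Pr => e e0; rewrite add0r.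
have z1' : l2norm z <= 1 by rewrite z1.
have /within_unit_ball_cvgP/(_ e e0)[d d0 H] := Au_ext_cvg f z z1'.
have -> : phi f - Au_ext f z = phi (f - Au_ext f z *: (1 : Au R)).
  by rewrite linearB linearZ/= phi1 [_ *: 1]mulr1.
apply: (character_local phi z _ e d) => // x xd.
rewrite -[X in normc X]/(f x - Au_ext f z * 1) mulr1 -normcN opprB ltW// H//.
by rewrite -opprB -scaleN1r l2normZ normcN normc1 mul1r.
Qed.

Theorem proposition2p7 (R : realType) (g : @unit_ball R -> ell2 R)
    (g_Hinf : @Hinf R (ell2 R) g)
    (g_constant : exists z : ell2 R, forall x : @unit_ball R, g x = z)
    (g_norm1 : Hinf_norm g = 1) :
  fiber g = [set comp_hom g].
Proof.
have [z gz] := g_constant; have {gz} gE : g = (fun _ => z) by apply/funext.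
have z1 : l2norm z = 1.
  rewrite -g_norm1 /Hinf_norm gE (_ : range _ = [set l2norm z]) ?sup1//.
  apply/seteqP; split=> [_ [_ _ <-]//|_ ->].
  by exists (exist _ 0 mem0_unit_ball).
rewrite {g g_Hinf g_constant g_norm1}gE; apply/seteqP; split; last first.
  by move=> _ ->; apply: comp_hom_fiber; rewrite z1.
move=> Phi [[Phi_lin PhiM _ _] Phi_xi]; apply/funext => f; apply/funext => x.
have Phi_pairing k : Phi (pairing R k) x = z k.
  exact: (congr1 (fun F => F x k) Phi_xi).
(* Evaluation at the fixed [x] turns [Phi] into a character. *)
have phi_lin : linear (fun f => Phi f x : R[i]).
  by move=> c u v; rewrite Phi_lin.
pose phi : {linear Au R -> R[i]} :=
  HB.pack (fun f => Phi f x : R[i]) (GRing.isLinear.Build _ _ _ _ _ phi_lin).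
have phiM : {morph phi : u v / u * v} by move=> u v; rewrite /phi/= PhiM.
apply: (character_eq_ext phi) => //.
(* Unitality of [phi] comes from [z]: a nonzero [z k] can be cancelled in
   [phi (pairing R k) * phi 1 = z k]. *)
have [k zk] : exists k, z k != 0.
  apply: contrapT => z0; have : z = 0.
    apply/val_inj/funext => k; apply: contrapT => /eqP zk.
    by apply: z0; exists k.
  move=> z0'; move: z1; rewrite z0' => /(congr1 (real_complex R)).
  rewrite -[LHS]/(`|0 : ell2 R|) normr0 => /eqP.
  by rewrite eq_sym oner_eq0.
have phizk : phi (pairing R k) = z k by exact: Phi_pairing.
by apply: (mulfI zk); rewrite -{1}phizk -phiM !mulr1.
Qed.
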